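(* Let $X$ be a compact, metric and totally disconnected space and let $f \colon X \to X$ be a continuous map. Consider the induced map $f^* \colon \check{H}^0(X;\mathbb{C}) \to \check{H}^0(X;\mathbb{C})$ in Čech cohomology. Then every nonzero eigenvalue of $f^*$ is a root of unity.
   Context: For a compact space $Z$, the Čech cohomology group $\check{H}^0(Z;\mathbb{C})$ is identified with the $\mathbb{C}$-vector space of all locally constant maps $\varphi \colon Z \to \mathbb{C}$. Under this identification the homomorphism $f^*$ induced by a continuous map $f \colon Z \to Z$ is $\varphi \mapsto \varphi \circ f$. *)

(* Defs.v *)
From HB Require Import structures.
From mathcomp Require Import all_boot all_order all_algebra.
From mathcomp Require Import all_classical all_reals all_analysis.
From mathcomp Require Export complex.

Set Implicit Arguments.
Unset Strict Implicit.
Unset Printing Implicit Defensive.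

Import GRing.Theory.

Local Open Scope classical_set_scope.
Local Open Scope ring_scope.

Definition locally_constant (X : topologicalType) (T : Type) (phi : X -> T) :=
  forall x : X, \forall y \near x, phi y = phi x.

(* [K^o] is [K] seen as a one-dimensional vector space over itself, so that
   [X -> K^o] carries the pointwise [lmodType K] structure. *)
Definition locally_constant_pred (X : topologicalType) (K : fieldType) :
  {pred X -> K^o} := [pred phi : X -> K^o | `[< locally_constant phi >]].

Fact locally_constant_submod (X : topologicalType) (K : fieldType) :
  submod_closed (@locally_constant_pred X K).
Proof.
split=> [|a u v /asboolP lcu /asboolP lcv]; apply/asboolP => x.
  by near=> y.
have lcux := lcu x; have lcvx := lcv x; near=> y.
rewrite [LHS]/(a *: u y + v y) [RHS]/(a *: u x + v x).
by congr (_ *: _ + _); near: y.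
Unshelve. all: by end_near. Qed.

HB.instance Definition _ (X : topologicalType) (K : fieldType) :=
  GRing.isSubmodClosed.Build K (X -> K^o) (@locally_constant_pred X K)
    (@locally_constant_submod X K).

(* The Cech cohomology group of degree 0 with coefficients in [K] of a compact
   space [X], as the [K]-vector space of all locally constant maps. *)
Record cechH0 (X : topologicalType) (K : fieldType) := CechH0 {
  cechH0_fun :> X -> K^o;
  cechH0_funP : cechH0_fun \in @locally_constant_pred X K
}.

HB.instance Definition _ (X : topologicalType) (K : fieldType) :=
  [isSub for @cechH0_fun X K].
HB.instance Definition _ (X : topologicalType) (K : fieldType) :=
  [Choice of cechH0 X K by <:].
HB.instance Definition _ (X : topologicalType) (K : fieldType) :=
  [SubChoice_isSubLmodule of cechH0 X K by <:].

Fact locally_constant_comp (X Y : topologicalType) (K : fieldType)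
    (f : continuousType X Y) (phi : cechH0 Y K) :
  (phi : Y -> K^o) \o f \in @locally_constant_pred X K.
Proof.
have /asboolP lcphi := cechH0_funP phi.
apply/asboolP => x; exact: (@cts_fun _ _ f x _ (lcphi (f x))).
Qed.

(* The homomorphism [f^*]. *)
Definition cech_pullback (X Y : topologicalType) (K : fieldType)
    (f : continuousType X Y) (phi : cechH0 Y K) : cechH0 X K :=
  CechH0 (locally_constant_comp f phi).

Fact cech_pullback_linear (X Y : topologicalType) (K : fieldType)
    (f : continuousType X Y) : linear (@cech_pullback X Y K f).
Proof. by move=> a u v; apply: val_inj. Qed.

HB.instance Definition _ (X Y : topologicalType) (K : fieldType)
    (f : continuousType X Y) :=
  GRing.isLinear.Build K (cechH0 Y K) (cechH0 X K) *:%R (@cech_pullback X Y K f)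
    (@cech_pullback_linear X Y K f).

(* The library only has eigenvalues in finite dimension. *)
Definition is_eigenvalue (K : fieldType) (V : lmodType K) (g : {linear V -> V})
    (a : K) : Prop := exists2 v : V, v != 0 & g v = a *: v.

Definition is_root_of_unity (K : fieldType) (a : K) : Prop :=
  exists2 n : nat, (0 < n)%N & n.-unity_root a.

(* Main.v *)
Require Import Defs.
From mathcomp Require Import all_boot all_order all_algebra.
From mathcomp Require Import all_classical all_reals all_analysis.

Import GRing.Theory.

Local Open Scope classical_set_scope.
Local Open Scope ring_scope.

(** Let [phi] be an eigenvector for [lambda], and choose [x] with
    [phi x != 0]. Along the orbit of [x] the function takes the values
    [phi (f^n x) = lambda^n * phi x]. By compactness the orbit accumulates at
    some point [p], and [phi] is constant near [p], so the orbit meets one level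
    set of [phi] at arbitrarily late times ([locally_constant_recurrence]). Two
    such times [m < n] give [lambda^m = lambda^n], and since [lambda] is
    invertible, [lambda^(n - m) = 1]. *)

(** A cluster point [p] of the sequence is visited at arbitrarily late times by
    any neighbourhood of [p], in particular by one on which [phi] is constant. *)
Lemma locally_constant_recurrence (X : topologicalType) (T : Type)
    (phi : X -> T) (u : nat -> X) :
  compact [set: X] -> locally_constant phi ->
  exists t : T, forall N : nat, exists2 n, (N <= n)%N & phi (u n) = t.
Proof.
move=> cX lcphi.
have [p [_ clp]] := cX (u @ \oo) _ filterT.
exists (phi p) => N.
have tailN : (u @ \oo) (u @` [set n | (N <= n)%N]).
  by exists N => // n /= leNn; exists n.
have [_ [[n leNn <-] phi_un]] := clp _ _ tailN (lcphi p).
by exists n.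
Qed.

Lemma cech_pullback_eigen_iter (X : topologicalType) (K : fieldType)
    (f : continuousType X X) (phi : cechH0 X K) (a : K) :
  cech_pullback f phi = a *: phi ->
  forall x n, phi (iter n f x) = a ^+ n * phi x.
Proof.
move=> eig x; elim=> [|n IHn]; first by rewrite mul1r.
by rewrite exprS -mulrA -IHn; exact: (congr1 (fun psi : cechH0 X K => psi _) eig).
Qed.

Theorem proposition1 (R : realType) (X : metricType R) (f : continuousType X X)
    (hcompact : compact [set: X])
    (htd : totally_disconnected [set: X])
    (lambda : R[i]) (hlambda0 : lambda != 0)
    (hlambda : is_eigenvalue (@cech_pullback X X R[i] f) lambda) :
  is_root_of_unity lambda.
Proof.
have [phi phi_neq0 eig] := hlambda.
have [x phix_neq0] : exists x, phi x != 0.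
  apply: contrapT => /forallNP phi0; case/eqP: phi_neq0.
  by apply/val_inj/funext => x; apply/eqP/negbNE/negP; exact: phi0.
have /asboolP lcphi := cechH0_funP phi.
have [t rec_t] :=
  locally_constant_recurrence _ _ phi (fun n => iter n f x) hcompact lcphi.
have [m _ phi_m] := rec_t 0%N.
have [n ltmn phi_n] := rec_t m.+1.
exists (n - m)%N; first by rewrite subn_gt0.
apply/unity_rootP/(mulfI (expf_neq0 m hlambda0)).
rewrite mulr1 -exprD subnKC ?(ltnW ltmn) //.
apply: (mulIf phix_neq0).
by rewrite -!(cech_pullback_eigen_iter _ _ _ _ _ eig) phi_m phi_n.
Qed.
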